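(* Let $N=\{1,\ldots,n\}$, $f\in\mathbb Z_+$, and let $\boldsymbol\beta\in\mathbb R^n_+$ satisfy $0\le\beta_1<\beta_2<\cdots<\beta_n$. Let $\psi(\mathbf x)=\max\{\boldsymbol\beta^\top\mathbf y:\ \mathbf y\in\{0,1\}^n,\ \mathbf y\le\mathbf 1-\mathbf x,\ \sum_{i=1}^ny_i\le f\}$ for $\mathbf x\in\{0,1\}^n$. Let $\mathcal I_X$ be either a partition matroid $\{\mathbf x\in\{0,1\}^n:\sum_{i\in L_k}x_i\le l_k\ \forall k\in\{1,\ldots,k_l\}\}$ (with $L_1,\ldots,L_{k_l}$ a partition of $N$ and $l_k\in\mathbb Z_+$) or, more generally, the family of incidence vectors of independent sets of an arbitrary matroid $X$ on $N$. Then the output $\mathbf x_g$ of the greedy algorithm described below (with any tie-breaking) satisfies $\mathbf x_g\in\mathcal I_X$ and $\psi(\mathbf x_g)=\min_{\mathbf x\in\mathcal I_X}\psi(\mathbf x)$.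
   Context: The greedy algorithm (Algorithm 2): start with $\mathbf x=\mathbf 0$; let $N(\mathbf x)=\{i\in N: x_i=0,\ \mathbf x+\mathbf e_i\in\mathcal I_X\}$; while $N(\mathbf x)\neq\emptyset$, choose $i^*\in\arg\min_{i\in N(\mathbf x)}(\psi(\mathbf x+\mathbf e_i)-\psi(\mathbf x))$ (ties broken arbitrarily), set $\mathbf x\leftarrow\mathbf x+\mathbf e_{i^*}$ and recompute $N(\mathbf x)$; output $\mathbf x_g=\mathbf x$. Here $\mathbf e_i$ is the $i$-th unit vector. The problem $\min_{\mathbf x\in\mathcal I_X}\psi(\mathbf x)$ is the partition matroid interdiction problem with a single follower capacity constraint ($k_f=1$). *)

(* Defs.v *)
From mathcomp Require Import all_boot all_order all_algebra.
From mathcomp Require Import reals.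
Set Implicit Arguments.
Unset Strict Implicit.
Unset Printing Implicit Defensive.
Import Order.TTheory GRing.Theory Num.Theory.
Local Open Scope ring_scope.

(* The ground set N = {1, ..., n} is 'I_n (0-based), and {0,1}^n is
   {ffun 'I_n -> bool}, the bits being coerced to nat in sums. *)
Notation binvec n := {ffun 'I_n -> bool}.

Definition binvec0 (n : nat) : binvec n := [ffun => false].

(* x + e_i; it agrees with the sum in Z^n only when x i = 0. *)
Definition add_unit (n : nat) (x : binvec n) (i : 'I_n) : binvec n :=
  [ffun j => x j || (j == i)].

Section Follower.
Variables (R : realType) (n : nat) (beta : 'I_n -> R) (f : nat).

(* y <= 1 - x and \sum_i y_i <= f. *)
Definition follower_feasible (x y : binvec n) : bool :=
  [forall i, (y i <= 1 - x i)%N] && (\sum_i y i <= f)%N.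

Definition follower_value (y : binvec n) : R := \sum_i beta i * (y i)%:R.

(* The default value 0 is harmless: y = 0 is always feasible, with value 0. *)
Definition psi (x : binvec n) : R :=
  \big[Num.max/0]_(y : binvec n | follower_feasible x y) follower_value y.

Lemma psi_max (x : binvec n) :
  (exists2 y, follower_feasible x y & psi x = follower_value y) /\
  (forall y, follower_feasible x y -> follower_value y <= psi x).
Proof.
have feas0 : follower_feasible x (binvec0 n).
  apply/andP; split; first by apply/forallP => i; rewrite ffunE.
  by rewrite big1 // => i _; rewrite ffunE.
have val0 : follower_value (binvec0 n) = 0.
  by rewrite /follower_value big1 // => i _; rewrite ffunE mulr0.
have le_psi y : follower_feasible x y -> follower_value y <= psi x.
  by move=> xy; rewrite /psi; exact: le_bigmax_cond.
split=> //.
have [] : psi x = 0 \/ exists2 y, follower_feasible x y & psi x = follower_value y.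
- rewrite /psi; elim/big_ind: _ => [|a b Ha Hb|y xy]; first by left.
  + by rewrite /Num.max; case: ifP.
  + by right; exists y.
- by move=> ->; exists (binvec0 n).
- by [].
Qed.

End Follower.

(* A matroid on T, given by its independent sets. *)
Definition is_matroid (T : finType) (X : {set {set T}}) : Prop :=
  [/\ set0 \in X,
      (forall A B : {set T}, A \subset B -> B \in X -> A \in X) &
      (forall A B : {set T}, A \in X -> B \in X -> (#|A| < #|B|)%N ->
         exists2 e, e \in B :\: A & e |: A \in X)].

Definition incidence (n : nat) (A : {set 'I_n}) : binvec n :=
  [ffun i => i \in A].

Definition matroid_vectors (n : nat) (IX : {set binvec n}) : Prop :=
  exists2 X : {set {set 'I_n}}, is_matroid X & IX = [set incidence A | A in X].

(* L_1, ..., L_kl partition N: the blocks are nonempty, pairwise distinct as an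
   indexed family, disjoint, and cover N. *)
Definition partition_matroid_vectors (n : nat) (IX : {set binvec n}) : Prop :=
  exists (kl : nat) (L : 'I_kl -> {set 'I_n}) (l : 'I_kl -> nat),
    [/\ injective L,
        partition [set L k | k : 'I_kl] [set: 'I_n] &
        IX = [set x : binvec n | [forall k, (\sum_(i in L k) x i <= l k)%N]]].

Section Greedy.
Variables (R : realType) (n : nat) (IX : {set binvec n}) (g : binvec n -> R).

Definition candidates (x : binvec n) : {set 'I_n} :=
  [set i | ~~ x i & add_unit x i \in IX].

Definition marginal (x : binvec n) (i : 'I_n) : R := g (add_unit x i) - g x.

Definition best_candidates (x : binvec n) : {set 'I_n} :=
  [set i in candidates x |
    [forall j in candidates x, marginal x i <= marginal x j]].

(* greedy_loop x xg: the while loop entered at x can end at xg for some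
   resolution of the ties. *)
Inductive greedy_loop : binvec n -> binvec n -> Prop :=
| greedy_stop x : candidates x = set0 -> greedy_loop x x
| greedy_next x i xg :
    i \in best_candidates x -> greedy_loop (add_unit x i) xg ->
    greedy_loop x xg.

Definition greedy_output (xg : binvec n) : Prop := greedy_loop (binvec0 n) xg.

Lemma greedy_output_exists : exists xg, greedy_output xg.
Proof.
rewrite /greedy_output; move: (binvec0 n) => x.
have [m] := ubnP #|[set i | ~~ x i]|.
elim: m x => // m IHm x lem.
have [x0|[i0 xi0]] := set_0Vmem (candidates x).
  by exists x; exact: greedy_stop.
have [i xi min_i] : exists2 i, i \in candidates x &
    forall j, j \in candidates x -> marginal x i <= marginal x j.
  by case: (arg_minP (marginal x) xi0) => i; exists i.
have [|xg xg_out] := IHm (add_unit x i).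
  rewrite -ltnS; apply: leq_trans lem; rewrite ltnS.
  apply: proper_card; apply/properP; split.
    by apply/subsetP => j; rewrite !inE ffunE negb_or => /andP[].
  exists i; first by move: xi; rewrite !inE; case/andP.
  by rewrite inE ffunE eqxx orbT.
exists xg; apply: greedy_next xg_out.
by rewrite inE xi; apply/forall_inP.
Qed.

End Greedy.

(* v is the minimum of g over the set A. *)
Definition is_min_over (R : realType) (T : finType) (A : {set T}) (g : T -> R)
    (v : R) : Prop :=
  (exists2 x, x \in A & g x = v) /\ (forall x, x \in A -> v <= g x).

(* Main.v *)
(** Write [c_t(x)] for the number of elements [i >= t] left free by [x]. Summing
    by layers, [psi x] is the sum over [t] of [d_t * min(f, c_t(x))], where
    the [d_t] are the successive differences of [beta]. The greedy output
    [xg] in fact minimizes every truncated count [min(f, c_t)] over the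
    matroid at once. This follows from an invariant of the loop: for every
    threshold [s], either the current [x] is contained in [{i >= s}], or
    [min(f, c_s(x))] is already minimal. If [x] is contained in [{i >= s}]
    and no candidate is [>= s], then [x] spans [{i >= s}] and [c_s(x)] is
    minimal by augmentation. If the loop picks [i < s] although the largest
    candidate [j] is [>= s], then the marginals of [i] and [j] agree, which
    forces [c_(j+1)(x) >= f]; the invariant at [j+1] then gives [c_s >=
    c_(j+1) >= f] on the whole matroid. *)
Require Import Defs.
From mathcomp Require Import all_boot all_order all_algebra.
From mathcomp Require Import reals.
From mathcomp Require Import zify.
Import Order.TTheory GRing.Theory Num.Theory.
Local Open Scope ring_scope.

Set Implicit Arguments.
Unset Strict Implicit.

Lemma incidenceE n (A : {set 'I_n}) i : incidence A i = (i \in A).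
Proof. by rewrite ffunE. Qed.

Lemma incidence_inj n : injective (@incidence n).
Proof. by move=> A B /ffunP eqAB; apply/setP => i; rewrite -!incidenceE eqAB. Qed.

Lemma incidence_support n (x : binvec n) : incidence [set i | x i] = x.
Proof. by apply/ffunP => i; rewrite ffunE inE. Qed.

Lemma add_unit_support n (x : binvec n) (i : 'I_n) :
  add_unit x i = incidence (i |: [set j | x j]).
Proof. by apply/ffunP => j; rewrite !ffunE !inE orbC. Qed.

(** * Partition matroids satisfy the matroid axioms *)

Section PartitionMatroid.
Variables (n kl : nat) (L : 'I_kl -> {set 'I_n}) (l : 'I_kl -> nat).
Hypothesis L_inj : injective L.
Hypothesis L_part : partition [set L k | k : 'I_kl] [set: 'I_n].

Lemma card_partition_blocks (A : {set 'I_n}) :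
  #|A| = (\sum_k #|A :&: L k|)%N.
Proof.
have -> : #|A| = (\sum_(i in [set: 'I_n]) (i \in A))%N.
  rewrite -sum1_card big_mkcond /=.
  by apply: eq_big => i; rewrite ?inE //; case: (i \in A).
rewrite (set_partition_big _ L_part) big_imset /=; last exact: in2W L_inj.
apply: eq_bigr => k _; rewrite -sum1_card big_mkcond [RHS]big_mkcond /=.
by apply: eq_bigr => i _; rewrite inE andbC; case: (i \in L k); case: (i \in A).
Qed.

Lemma block_uniq (e : 'I_n) (j k : 'I_kl) : e \in L j -> e \in L k -> j = k.
Proof.
have /and3P[_ trivL _] := L_part; move=> ej ek; apply: L_inj.
by rewrite -(def_pblock trivL _ ej) ?imset_f // (def_pblock trivL _ ek) ?imset_f.
Qed.

(** For augmentation, pigeonhole over the blocks gives a block where [B] has more elements than [A].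
    Adding one of them to [A] changes only that block's count, which stays bounded by that of
    [B]. *)
Lemma partition_is_matroid :
  is_matroid [set A : {set 'I_n} | [forall k, (#|A :&: L k| <= l k)%N]].
Proof.
split=> [|A B sAB|A B].
- by rewrite inE; apply/forallP => k; rewrite set0I cards0.
- rewrite !inE => /forallP lB; apply/forallP => k.
  by apply: leq_trans (lB k); rewrite subset_leq_card // setSI.
rewrite !inE => /forallP lA /forallP lB ltAB.
have [k ltk] : exists k, (#|A :&: L k| < #|B :&: L k|)%N.
  apply/existsP; apply: contraLR ltAB => /existsPn leBA.
  rewrite -leqNgt [#|A|]card_partition_blocks [#|B|]card_partition_blocks.
  by apply: leq_sum => k _; rewrite leqNgt.
have [e eB eA] : exists2 e, e \in B :&: L k & e \notin A :&: L k.
  apply/subsetPn; apply: contraL ltk => /subset_leq_card.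
  by rewrite -leqNgt.
move: eB eA; rewrite !inE => /andP[eB ek]; rewrite ek andbT => eA.
exists e; first by rewrite inE eA.
rewrite inE; apply/forallP => j; rewrite setIUl.
have [<-|neq_kj] := eqVneq k j.
  have /setIidPl-> : [set e] \subset L k by rewrite sub1set.
  by rewrite cardsU1 inE (negPf eA) /= add1n; apply: leq_trans (lB k).
suff -> : [set e] :&: L j = set0 by rewrite set0U.
apply/setP => i; rewrite !inE; apply/andP => -[/eqP-> ej].
by move/eqP: neq_kj; apply; apply: block_uniq ek ej.
Qed.

End PartitionMatroid.

Lemma partition_matroid_vectors_matroid n (IX : {set binvec n}) :
  partition_matroid_vectors IX -> matroid_vectors IX.
Proof.
case=> kl [L [l [L_inj L_part ->]]].
exists [set A : {set 'I_n} | [forall k, (#|A :&: L k| <= l k)%N]].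
  exact: partition_is_matroid.
have cardL (x : binvec n) k :
    (\sum_(i in L k) x i)%N = #|[set i | x i] :&: L k|.
  rewrite -sum1_card big_mkcond [RHS]big_mkcond /=.
  by apply: eq_bigr => i _; rewrite !inE andbC; case: (i \in L k); case: (x i).
apply/setP => x; rewrite -[x in RHS]incidence_support mem_imset ?inE;
  last exact: incidence_inj.
by under eq_forallb do rewrite cardL.
Qed.

(** * Counting chosen and free elements above a threshold *)

Section TailCount.
Variable n : nat.
Implicit Types (x y : binvec n) (t : nat).

Definition tail t x : nat := (\sum_(i < n | (t <= i)%N) x i)%N.

Definition free t x : nat := tail t [ffun i => ~~ x i].

Lemma tail_ge t x : (n <= t)%N -> tail t x = 0%N.
Proof.
by move=> nt; apply: big1 => i ti; have := ltn_ord i; rewrite ltnNge (leq_trans nt ti).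
Qed.

Lemma tail_ord (t : 'I_n) x : tail t x = (x t + tail t.+1 x)%N.
Proof.
rewrite /tail (bigD1 t) //=; congr (_ + _)%N.
by apply: eq_bigl => i; rewrite ltn_neqAle andbC eq_sym.
Qed.

Lemma tailS x s t : (s <= t)%N -> (tail t x <= tail s x)%N.
Proof.
move=> st; rewrite /tail big_mkcond [X in (_ <= X)%N]big_mkcond /=.
by apply: leq_sum => i _; case: ifP => // ti; rewrite (leq_trans st ti).
Qed.

Lemma tail_mono t x y : (forall i, x i -> y i) -> (tail t x <= tail t y)%N.
Proof. by move=> xy; apply: leq_sum => i _; move: (xy i); case: (x i) => // ->. Qed.

Lemma tail_free t x y :
  (tail t x <= tail t y)%N = (free t y <= free t x)%N.
Proof.
have split_tail z : (tail t z + free t z = \sum_(i < n | (t <= i)%N) 1)%N.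
  by rewrite -big_split /=; apply: eq_bigr => i _; rewrite ffunE; case: (z i).
by have := split_tail x; have := split_tail y; lia.
Qed.

Lemma tail_card t x : tail t x = #|[set i | x i && (t <= i)%N]|.
Proof.
rewrite /tail -sum1_card big_mkcond [RHS]big_mkcond /=; apply: eq_bigr => i _.
by rewrite inE andbC; case: (t <= i)%N; case: (x i).
Qed.

Lemma free_add_unit t x i : ~~ x i ->
  free t x = ((t <= i)%N + free t (add_unit x i))%N.
Proof.
move=> xi; rewrite /free /tail.
case: leqP => ti; last first.
  apply: eq_bigr => j tj; rewrite !ffunE.
  have /negPf-> : j != i by apply: contraTneq tj => ->; rewrite -ltnNge.
  by rewrite orbF.
rewrite (bigD1 i) //= [in RHS](bigD1 i) //= !ffunE eqxx orbT xi /= add0n.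
by congr (_ + _)%N; apply: eq_bigr => j /andP[_ /negPf ji]; rewrite !ffunE ji orbF.
Qed.

End TailCount.

(** * Layer formula for [psi] and comparison of marginals *)

Section LayerFormula.
Variables (R : realType) (n f : nat) (beta : 'I_n -> R).
Hypothesis beta_ge0 : forall i : 'I_n, 0 <= beta i.
Hypothesis beta_incr : forall i j : 'I_n, (i < j)%N -> beta i < beta j.

Definition increment (t : nat) : R :=
  oapp beta 0 (insub t) - (if t is s.+1 then oapp beta 0 (insub s) else 0).

(** Layer [0] is excluded because its increment is the smallest weight itself, which may vanish. *)
Lemma increment_gt0 (t : 'I_n) : (0 < t)%N -> 0 < increment t.
Proof.
rewrite /increment valK /=; case: t => -[|t] //= lt_tn _.
by rewrite insubT ?(ltnW lt_tn) //= => ltt; rewrite subr_gt0 beta_incr.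
Qed.

Lemma increment_ge0 (t : 'I_n) : 0 <= increment t.
Proof.
have [t0|/increment_gt0/ltW//] := posnP t.
by rewrite /increment valK /= t0 subr0.
Qed.

Lemma sum_increment (i : 'I_n) :
  beta i = \sum_(t < n | (t <= i)%N) increment t.
Proof.
(* The weights are shifted by one, with [b 0 = 0], so that the telescoping sum leaves exactly
   [beta i]. *)
pose b t : R := if t is s.+1 then oapp beta 0 (insub s) else 0.
have -> : beta i = \sum_(0 <= t < i.+1) (b t.+1 - b t).
  by rewrite telescope_sumr // subr0 /b /= valK.
rewrite big_mkord (big_ord_widen _ (fun t => b t.+1 - b t) (ltn_ord i)).
by apply: eq_big.
Qed.

Lemma follower_value_layers (y : binvec n) :
  follower_value beta y = \sum_(t < n) increment t * (tail t y)%:R.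
Proof.
rewrite /follower_value.
under eq_bigr => i _ do rewrite sum_increment mulr_suml big_mkcond /=.
rewrite exchange_big /=; apply: eq_bigr => t _.
by rewrite -big_mkcond /= /tail natr_sum mulr_sumr.
Qed.

(** The follower's greedy response: take free elements from the top until [f] are taken. *)
Definition top_free (x : binvec n) : binvec n :=
  [ffun i : 'I_n => ~~ x i && (free i.+1 x < f)%N].

Lemma tail_top_free t (x : binvec n) : tail t (top_free x) = minn f (free t x).
Proof.
(* Downward induction on [t], starting beyond the last index. *)
have [m] := ubnP (n - t); elim: m t => // m IHm t lem.
have [nt|tn] := leqP n t; first by rewrite /free !tail_ge // minn0.
rewrite /free !(tail_ord (Ordinal tn)) /= IHm; last by lia.
by rewrite !ffunE /= -/(free t.+1 x); case: (x _) => /=; lia.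
Qed.

(** Each tail of a feasible response is bounded by both [f] and the free count, and [top_free x]
    attains all these bounds simultaneously. *)
Lemma psi_layers (x : binvec n) :
  psi beta f x = \sum_(t < n) increment t * (minn f (free t x))%:R.
Proof.
have tail0 (y : binvec n) : (\sum_i y i)%N = tail 0 y by apply: eq_bigl.
have [[y feas_y psi_y] psi_ub] := psi_max beta f x.
apply/le_anti/andP; split.
  rewrite psi_y follower_value_layers; apply: ler_sum => t _.
  rewrite ler_wpM2l ?increment_ge0 // ler_nat leq_min.
  case/andP: feas_y => /forallP yx; rewrite tail0 => y_f.
  rewrite (leq_trans (tailS _ (leq0n t)) y_f) /=.
  by apply: tail_mono => i yi; have := yx i; rewrite ffunE yi; case: (x i).
under eq_bigr => t _ do rewrite -tail_top_free.
rewrite -follower_value_layers; apply: psi_ub; apply/andP; split.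
  by apply/forallP => i; rewrite ffunE; case: (x i) => //=; case: (_ < _)%N.
by rewrite tail0 tail_top_free geq_minl.
Qed.

(* Removing [j] lowers every layer at least as much as removing [i < j] does,
   so a weakly better marginal at [i] makes all layers agree, the [j]-th one
   in particular. *)
Lemma marginal_le_free (x : binvec n) (i j : 'I_n) : ~~ x i -> ~~ x j ->
  (i < j)%N -> marginal (psi beta f) x i <= marginal (psi beta f) x j ->
  (f <= free j.+1 x)%N.
Proof.
move=> xi xj ij; rewrite lerD2r !psi_layers leNgt.
apply: contraNT; rewrite -ltnNge => ltf.
rewrite (bigD1 j) //= [ltRHS](bigD1 j) //=.
have layer t := (free_add_unit t xi, free_add_unit t xj).
apply: ltr_leD.
  (* Layer [j] has positive weight since [j > i >= 0]. Its free count is at most [f] before removal,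
     so removing [j] lowers the truncated count while removing [i] does not. *)
  rewrite ltr_pM2l ?increment_gt0 ?(leq_ltn_trans _ ij) // ltr_nat.
  move: ltf; have := tail_ord j [ffun k => ~~ x k]; rewrite -!/(free _ _) ffunE xj.
  by have [] := layer j; rewrite leqnn leqNgt ij /=; lia.
apply: ler_sum => t _; rewrite ler_wpM2l ?increment_ge0 // ler_nat.
by have [] := layer t; lia.
Qed.

End LayerFormula.

(** * The loop invariant and its preservation *)

Section GreedyLoop.
Variables (R : realType) (n f : nat) (beta : 'I_n -> R).
Hypothesis beta_ge0 : forall i : 'I_n, 0 <= beta i.
Hypothesis beta_incr : forall i j : 'I_n, (i < j)%N -> beta i < beta j.
Variable X : {set {set 'I_n}}.
Hypothesis X_matroid : is_matroid X.

Let IX : {set binvec n} := [set incidence A | A in X].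

Lemma mem_incidence A : (incidence A \in IX) = (A \in X).
Proof. by rewrite mem_imset //; exact: incidence_inj. Qed.

(** Otherwise the part of [y] above [s], still independent, is larger than [x], and augmenting [x]
    from it yields a candidate [>= s]. *)
Lemma free_min_augmentation s (x y : binvec n) :
  x \in IX -> y \in IX -> (forall i, x i -> (s <= i)%N) ->
  (forall i, i \in candidates IX x -> (i < s)%N) ->
  (free s x <= free s y)%N.
Proof.
have [_ X_sub X_aug] := X_matroid.
rewrite -(incidence_support x) -(incidence_support y) !mem_incidence.
rewrite !incidence_support => xX yX xs no_cand; rewrite -tail_free leqNgt.
apply/negP; rewrite !tail_card => lt_xy.
have [||e] := X_aug [set i | x i] [set i | y i && (s <= i)%N] xX.
- by apply: X_sub yX; apply/subsetP => i; rewrite !inE => /andP[].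
- apply: leq_ltn_trans lt_xy; apply/subset_leq_card/subsetP => i.
  by rewrite !inE => xi; rewrite xi xs.
rewrite !inE => /and3P[xe _ se] eX.
have := no_cand e; rewrite inE xe add_unit_support mem_incidence eX ltnNge se.
by move/(_ isT).
Qed.

Definition layers_settled (x : binvec n) : Prop :=
  forall s, (forall i, x i -> (s <= i)%N) \/
    (forall y, y \in IX -> (minn f (free s x) <= minn f (free s y))%N).

Lemma settled_above_candidates s (x y : binvec n) :
  x \in IX -> layers_settled x -> y \in IX ->
  (forall i, i \in candidates IX x -> (i < s)%N) ->
  (minn f (free s x) <= minn f (free s y))%N.
Proof.
move=> xX inv yX no_cand; have [xs|] := inv s; last exact.
by have := free_min_augmentation xX yX xs no_cand; lia.
Qed.

Lemma layers_settled_step (x : binvec n) i :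
  x \in IX -> layers_settled x -> i \in best_candidates IX (psi beta f) x ->
  layers_settled (add_unit x i).
Proof.
move=> xX inv; rewrite inE => /andP[cand_i /forall_inP best_i] s.
have xi : ~~ x i by move: cand_i; rewrite inE => /andP[].
have free_le t := leq_trans (leq_addl _ _) (eq_leq (esym (free_add_unit t xi))).
(* A layer already minimal at [x] stays so, since adding an element never raises a free count. *)
have settled :
    (forall y, y \in IX -> (minn f (free s x) <= minn f (free s y))%N) ->
    forall y, y \in IX ->
      (minn f (free s (add_unit x i)) <= minn f (free s y))%N.
  by move=> sx y /sx; have := free_le s; lia.
have [xs|/settled] := inv s; last by right.
have [si|i_s] := leqP s i.
  by left=> j; rewrite ffunE => /orP[/xs|/eqP->].
right; apply: settled => y yX.
have [j cand_j max_j] : exists2 j, j \in candidates IX x &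
    forall k, k \in candidates IX x -> (k <= j)%N.
  by case: (@arg_maxnP _ i (mem (candidates IX x)) val cand_i) => j; exists j.
have [j_s|sj] := ltnP j s.
  by apply: settled_above_candidates => // k /max_j kj; apply: leq_ltn_trans j_s.
have xj : ~~ x j by move: cand_j; rewrite inE => /andP[].
(* Layer [j.+1] of [x] is saturated at [f] and minimal, so every [y] has at least [f] free elements
   above [j], hence above [s]. *)
have := marginal_le_free beta_ge0 beta_incr xi xj (leq_trans i_s sj)
  (best_i _ cand_j).
have := @settled_above_candidates j.+1 _ _ xX inv yX max_j.
by have := tailS [ffun k => ~~ y k] (leqW sj); rewrite -!/(free _ _); lia.
Qed.

Lemma greedy_loop_min (x xg : binvec n) :
  greedy_loop IX (psi beta f) x xg -> x \in IX -> layers_settled x ->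
  xg \in IX /\ forall s y, y \in IX ->
    (minn f (free s xg) <= minn f (free s y))%N.
Proof.
elim=> {x xg} [x no_cand|x i xg best_i _ IH] xX inv.
  (* With no candidates left, the bound on candidates holds vacuously for every [s]. *)
  split=> // s y yX; apply: settled_above_candidates => // i.
  by rewrite no_cand inE.
apply: IH; last exact: layers_settled_step.
by move: best_i; rewrite !inE => /andP[/andP[]].
Qed.

End GreedyLoop.

Unset Implicit Arguments.
Set Strict Implicit.

Theorem theorem4 (R : realType) (n f : nat) (beta : 'I_n -> R)
    (IX : {set binvec n})
    (beta_ge0 : forall i : 'I_n, 0 <= beta i)
    (beta_incr : forall i j : 'I_n, (i < j)%N -> beta i < beta j)
    (IX_matroid : partition_matroid_vectors IX \/ matroid_vectors IX)
    (xg : binvec n) (xg_greedy : greedy_output IX (psi beta f) xg) :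
  xg \in IX /\ is_min_over IX (psi beta f) (psi beta f xg).
Proof.
have {IX_matroid} [X X_matroid defIX] : matroid_vectors IX.
  by case: IX_matroid => // /partition_matroid_vectors_matroid.
subst IX; have [||xgX min_xg] :=
  greedy_loop_min beta_ge0 beta_incr X_matroid xg_greedy.
- have -> : binvec0 n = incidence set0 by apply/ffunP => i; rewrite !ffunE inE.
  by apply: imset_f; case: X_matroid.
(* The empty start lies above every threshold. *)
- by move=> s; left=> i; rewrite ffunE.
split=> //; split; first by exists xg.
move=> y yX; rewrite !psi_layers //; apply: ler_sum => t _.
by rewrite ler_wpM2l ?increment_ge0 // ler_nat min_xg.
Qed.
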